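(* Let $d\ge2$, $S>0$, $t>0$, and let $\mathcal{E}_d(t)$ be the reflecting hyperbolic Bessel process defined in the context. The kernel related to $(\mathcal{E}_d(t))_{t\ge0}$ is $$\overline{u}_d(\eta,t)=u_d(\eta,t)+u_d\left(\frac{S^2}{\eta},t\right),\qquad 0<\eta\le S,$$ while its density function is $$\overline{p}_d(\eta,t)=(\sinh\eta)^{d-1}u_d(\eta,t)+\left(\frac S\eta\right)^2\left(\sinh\left(\frac{S^2}{\eta}\right)\right)^{d-1}u_d\left(\frac{S^2}{\eta},t\right),\qquad 0<\eta\le S.$$
   Context: $\mathbb{H}_d=\{(x_1,\dots,x_d)\in\mathbb{R}^d: x_d>0\}$ is the Poincaré half-space with metric $ds^2=x_d^{-2}\sum_{i=1}^d dx_i^2$, and $\eta_d(t)$ is the hyperbolic distance at time $t$ from the origin $(0,\dots,0,1)$ of hyperbolic Brownian motion (generator one half of the Laplace-Beltrami operator) started at that origin; it satisfies $d\eta_d(t)=\frac{d-1}{2\tanh\eta_d(t)}dt+dW(t)$, $\eta_d(0)=0$, with $W$ a standard Wiener process. Its kernel $u_d(\eta,t)$ solves $\frac{\partial}{\partial t}u_d=\frac{1}{2\sinh^{d-1}\eta}\frac{\partial}{\partial\eta}\left(\sinh^{d-1}\eta\frac{\partial}{\partial\eta}u_d\right)$, $u_d(\eta,0)=\delta(\eta)$, normalized so that the probability density of $\eta_d(t)$ is $p_d(\eta,t)=u_d(\eta,t)\sinh^{d-1}\eta$, $\eta>0$. The reflecting hyperbolic Bessel process in the hyperbolic ball of radius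 $S$ centred at the origin is $$\mathcal{E}_d(t)=\begin{cases}\eta_d(t),&\eta_d(t)\in(0,S),\\ S^2/\eta_d(t),&\eta_d(t)\in[S,\infty).\end{cases}$$ The kernel of $\mathcal{E}_d$ at $\eta\in(0,S]$ is the sum of the kernel of $\eta_d$ at $\eta$ and the kernel of $\eta_d$ at the inverse point $S^2/\eta$. *)

(* Defs.v *)
From HB Require Import structures.
From mathcomp Require Import all_boot all_order all_algebra.
From mathcomp Require Import all_classical all_reals all_analysis.

Set Implicit Arguments.
Unset Strict Implicit.
Unset Printing Implicit Defensive.

Import Order.TTheory GRing.Theory Num.Theory.
Import numFieldNormedType.Exports.

Local Open Scope classical_set_scope.
Local Open Scope ring_scope.

Definition sinh (R : realType) (x : R) : R := (expR x - expR (- x)) / 2.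
Definition cosh (R : realType) (x : R) : R := (expR x + expR (- x)) / 2.
Definition tanh (R : realType) (x : R) : R := sinh x / cosh x.

(* The half-space of dimension d = n.+1; its points are row vectors, and the
   distinguished coordinate x_d is the last one. *)

Definition height (R : realType) (n : nat) (x : 'rV[R]_n.+1) : R :=
  x ord0 ord_max.

Definition half_space (R : realType) (n : nat) : set 'rV[R]_n.+1 :=
  [set x | 0 < height x].

Definition origin (R : realType) (n : nat) : 'rV[R]_n.+1 :=
  delta_mx ord0 ord_max.

Definition coord_dir (R : realType) (n : nat) (i : 'I_n.+1) : 'rV[R]_n.+1 :=
  delta_mx ord0 i.

Definition C1_curve (R : realType) (n : nat) (g : R -> 'rV[R]_n.+1) : Prop :=
  forall i, (forall s, derivable (fun r => g r ord0 i) s 1) /\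
            continuous (derive1 (fun r => g r ord0 i)).

(* Length on [0, 1] for the metric x_d^-2 * \sum_i dx_i^2. *)
Definition hyp_length (R : realType) (n : nat) (g : R -> 'rV[R]_n.+1) : R :=
  \int[lebesgue_measure]_(s in `[0, 1])
    (Num.sqrt (\sum_(i < n.+1) (derive1 (fun r => g r ord0 i) s) ^+ 2)
       / height (g s)).

Definition hyp_dist (R : realType) (n : nat) (x y : 'rV[R]_n.+1) : R :=
  inf [set hyp_length g | g in
        [set g : R -> 'rV[R]_n.+1 |
          [/\ C1_curve g, g 0 = x, g 1 = y &
              forall s, 0 <= s <= 1 -> half_space (g s)]]].

(* |g|^(-1/2) * \sum_i d_i (|g|^(1/2) * g^ii * d_i f), where g_ij is
   x_d^-2 * delta_ij, so that |g|^(1/2) = x_d^-d and g^ii = x_d^2. *)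
Definition laplace_beltrami (R : realType) (n : nat)
    (f : 'rV[R]_n.+1 -> R) (x : 'rV[R]_n.+1) : R :=
  height x ^+ n.+1 *
    \sum_(i < n.+1)
      'D_(coord_dir R i)
        (fun y => height y ^- n.+1 *
                  (height y ^+ 2 * 'D_(coord_dir R i) f y)) x.

Definition C1_fun (R : realType) (n : nat) (f : 'rV[R]_n.+1 -> R) : Prop :=
  forall i : 'I_n.+1, (forall x, derivable f x (coord_dir R i)) /\
                      continuous (fun x => 'D_(coord_dir R i) f x).

Definition test_function (R : realType) (n : nat)
    (f : 'rV[R]_n.+1 -> R) : Prop :=
  [/\ continuous f, C1_fun f,
      forall i : 'I_n.+1, C1_fun (fun x => 'D_(coord_dir R i) f x) &
      exists K : set 'rV[R]_n.+1,
        [/\ compact K, K `<=` @half_space R n & forall x, ~ K x -> f x = 0]].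

Definition natural_filtration (R : realType) (disp : measure_display)
    (T : measurableType disp) (n : nat) (X : R -> T -> 'rV[R]_n.+1) (s : R) :
    set (set T) :=
  <<s [set A | exists r (i : 'I_n.+1) (B : set R),
         [/\ 0 <= r <= s, measurable B &
             A = (fun w => X r w ord0 i) @^-1` B]] >>.

(* Diffusion with generator (1/2) * laplace_beltrami, i.e. the continuous
   solution of the corresponding martingale problem, started at the origin. *)
Definition hyperbolic_brownian_motion (R : realType) (disp : measure_display)
    (T : measurableType disp) (P : probability T R) (n : nat)
    (X : R -> T -> 'rV[R]_n.+1) : Prop :=
  [/\ forall t (i : 'I_n.+1), 0 <= t ->
        measurable_fun setT (fun w => X t w ord0 i),
      forall w, X 0 w = origin R n,
      forall w t, 0 <= t -> half_space (X t w),
      forall w, {within `[0, +oo[, continuous (fun t => X t w)} &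
      forall f, test_function f ->
        forall s t, 0 <= s -> s <= t ->
        forall A, natural_filtration X s A ->
        \int[P]_(w in A)
          (f (X t w) - f (X s w)
           - \int[lebesgue_measure]_(r in `[s, t])
               (2^-1 * laplace_beltrami f (X r w))) = 0].

Definition wiener_process (R : realType) (disp : measure_display)
    (T : measurableType disp) (P : probability T R) (W : R -> T -> R) : Prop :=
  [/\ forall t, 0 <= t -> measurable_fun setT (W t),
      forall w, W 0 w = 0,
      forall w, {within `[0, +oo[, continuous (fun t => W t w)} &
      (* independent increments, W t - W s of law N(0, t - s); the second
         parameter of normal_prob is the standard deviation *)
      forall (m : nat) (t : nat -> R) (B : nat -> set R),
        0 <= t 0%N -> (forall i, t i < t i.+1) ->
        (forall i, measurable (B i)) ->
        (P [set w | forall i, (i < m)%N -> B i (W (t i.+1) w - W (t i) w)%R] =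
         \prod_(i < m) normal_prob 0%R (Num.sqrt (t i.+1 - t i))%R (B i))%E].

(* The drift is singular where eta vanishes; its integrability is part of the
   meaning of the stochastic differential equation. *)
Definition bessel_sde (R : realType) (disp : measure_display)
    (T : measurableType disp) (P : probability T R) (d : nat)
    (eta W : R -> T -> R) : Prop :=
  {ae P, forall w, forall t, 0 <= t ->
    let drift s := d.-1%:R / (2 * tanh (eta s w)) in
    lebesgue_measure.-integrable `[0, t] (EFin \o drift) /\
    eta t w = \int[lebesgue_measure]_(s in `[0, t]) drift s + W t w}.

(* For 0 < d, d.-1.+1 is d. *)
Definition hyperbolic_bessel (R : realType) (disp : measure_display)
    (T : measurableType disp) (P : probability T R) (d : nat)
    (eta : R -> T -> R) : Prop :=
  (exists X : R -> T -> 'rV[R]_d.-1.+1,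
     hyperbolic_brownian_motion P X /\
     forall t w, 0 <= t -> eta t w = hyp_dist (origin R d.-1) (X t w)) /\
  (exists W : R -> T -> R, wiener_process P W /\ bessel_sde P d eta W).

Definition has_density (R : realType) (disp : measure_display)
    (T : measurableType disp) (P : probability T R)
    (Y : T -> R) (D : set R) (p : R -> R) : Prop :=
  [/\ measurable_fun setT Y, measurable_fun D p, (forall x, D x -> 0 <= p x) &
      forall A : set R, measurable A ->
        P (Y @^-1` A) = (\int[lebesgue_measure]_(x in A `&` D) (p x)%:E)%E].

Definition kernel_pde (R : realType) (d : nat) (u : R -> R -> R) : Prop :=
  forall x t : R, 0 < x -> 0 < t ->
    let flux y := sinh y ^+ d.-1 * derive1 (fun z => u z t) y in
    [/\ derivable (u x) t 1, derivable (fun z => u z t) x 1,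
        derivable flux x 1 &
        derive1 (u x) t = (2 * sinh x ^+ d.-1)^-1 * derive1 flux x].

(* u(., 0) = delta, the Dirac mass at 0 being understood with respect to the
   radial volume element sinh(x)^(d-1) dx. *)
Definition kernel_initial (R : realType) (d : nat) (u : R -> R -> R) : Prop :=
  forall f : R -> R, continuous f -> (exists M, forall x, `|f x| <= M) ->
    (fun t => \int[lebesgue_measure]_(x in `]0, +oo[)
                (f x * (u x t * sinh x ^+ d.-1))) @ 0^'+ --> f 0.

Definition bessel_kernel (R : realType) (disp : measure_display)
    (T : measurableType disp) (P : probability T R) (d : nat)
    (eta : R -> T -> R) (u : R -> R -> R) : Prop :=
  [/\ kernel_pde d u, kernel_initial d u &
      forall t, 0 < t ->
        has_density P (eta t) `]0, +oo[ (fun x => u x t * sinh x ^+ d.-1)].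

(* Points eta = 0, reached only at t = 0 up to null sets, are left fixed. *)
Definition reflecting_bessel (R : realType) (T : Type) (S : R)
    (eta : R -> T -> R) (t : R) (w : T) : R :=
  if eta t w < S then eta t w else S ^+ 2 / eta t w.

Definition inverse_point (R : realType) (S x y : R) : Prop :=
  0 < y /\ x * y = S ^+ 2.

Definition reflecting_bessel_kernel (R : realType) (disp : measure_display)
    (T : measurableType disp) (P : probability T R) (d : nat) (S : R)
    (eta : R -> T -> R) (v : R -> R -> R) : Prop :=
  exists2 u, bessel_kernel P d eta u &
    forall x y t, 0 < x <= S -> inverse_point S x y -> 0 < t ->
      v x t = u x t + u y t.

(* Main.v *)
(* The inversion y |-> S^2 / y exchanges ]0, S] and [S, +oo[, so a continuous
   density p on ]0, +oo[ is transported by the reflection to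
   p x + (S / x)^2 p (S^2 / x) on ]0, S].  The change of variables is classical
   on compact intervals; it extends to Borel sets because the two sides are
   measures agreeing on a pi-system.
   Solutions of the kernel equation are continuous in the space variable, and
   two continuous densities of one law coincide everywhere, so the kernel given
   by the definition of ubar is u. *)
Require Import Defs.
From HB Require Import structures.
From mathcomp Require Import all_boot all_order all_algebra.
From mathcomp Require Import all_classical all_reals all_analysis.
From mathcomp Require Import measurable_realfun lra.

Set Implicit Arguments.
Unset Strict Implicit.
Unset Printing Implicit Defensive.

Import Order.TTheory GRing.Theory Num.Theory.
Import numFieldNormedType.Exports.
Local Open Scope classical_set_scope.
Local Open Scope ring_scope.

(** * Image of a measure with density under a measurable map *)

Section image_density_measure.
Context {R : realType} {d1 d2 : measure_display}.
Context {T1 : measurableType d1} {T2 : measurableType d2}.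
Variables (mu : {measure set T1 -> \bar R}) (phi : T1 -> T2) (f : T1 -> \bar R).
Hypotheses (mphi : measurable_fun setT phi).
Hypotheses (mf : measurable_fun setT f) (f0 : forall x, (0 <= f x)%E).

(** The push-forward along [phi] of the measure with density [f] with respect to [mu]. The three
    proofs are arguments of the definition, so that the term itself carries what the measure
    instance below requires. *)
Definition image_density_measure & measurable_fun setT phi
    & measurable_fun setT f & forall x, (0 <= f x)%E :=
  fun A : set T2 => (\int[mu]_(x in phi @^-1` A) f x)%E.

Local Notation nu := (image_density_measure mphi mf f0).

Let nu0 : nu set0 = 0%E.
Proof. by rewrite /image_density_measure preimage_set0 integral_set0. Qed.

Let nu_ge0 A : (0 <= nu A)%E. Proof. by apply: integral_ge0. Qed.

Let nu_sigma_additive : semi_sigma_additive nu.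
Proof.
move=> F mF tF mUF; rewrite /image_density_measure preimage_bigcup.
have mpre (B : set T2) : measurable B -> measurable (phi @^-1` B).
  by move=> mB; rewrite -[X in measurable X]setTI; exact: mphi.
apply: (@semi_sigma_additive_nng_induced _ _ _ mu f mf f0) => [n||].
- exact: mpre.
- apply/trivIsetP => i j _ _ ij; rewrite -preimage_setI.
  by move/trivIsetP : tF => /(_ _ _ _ _ ij) ->//; rewrite preimage_set0.
- by rewrite -preimage_bigcup; exact: mpre.
Qed.

HB.instance Definition _ :=
  isMeasure.Build _ _ _ nu nu0 nu_ge0 nu_sigma_additive.

End image_density_measure.

(** * The inversion [x |-> K / x] on the positive half-line: continuity, measurability,
    derivative *)

Lemma continuous_inversion (R : realType) (K x : R) : 0 < x ->
  {for x, continuous (fun y : R => K / y)}.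
Proof.
move=> x0; apply: cvgMr; apply: cvgV; first by rewrite gt_eqF.
exact: cvg_id.
Qed.

Lemma measurable_fun_continuous_pos (R : realType) (h : R -> R) :
  {in `]0, +oo[, continuous h} -> measurable_fun (`]0, +oo[%classic : set R) h.
Proof.
move=> ch; apply: open_continuous_measurable_fun; first exact: interval_open.
by move=> x; rewrite inE; exact: ch.
Qed.

Lemma continuous_inversion_density (R : realType) (K : R) (f : R -> R) :
  0 < K -> {in `]0, +oo[, continuous f} ->
  {in `]0, +oo[, continuous (fun x : R => K / x ^+ 2 * f (K / x))}.
Proof.
move=> K0 cf.
suff cg (x : R) : 0 < x ->
    {for x, continuous (fun y : R => K / y ^+ 2 * f (K / y))}.
  by move=> x; rewrite in_itv/= andbT; exact: cg.
move=> x0; apply: cvgM.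
  apply: cvgMr; apply: cvgV; first by rewrite expf_neq0 ?gt_eqF.
  exact: exprn_continuous.
apply: (cvg_comp (fun y : R => K / y) f (@continuous_inversion R K x x0)).
by apply: cf; rewrite in_itv/= divr_gt0.
Qed.

Lemma inversion_density_ge0 (R : realType) (K : R) (f : R -> R) :
  0 < K -> (forall x, 0 < x -> 0 <= f x) ->
  forall x, 0 < x -> 0 <= K / x ^+ 2 * f (K / x).
Proof.
move=> K0 f0 x x0; rewrite mulr_ge0//; first by rewrite divr_ge0 ?sqr_ge0 ?ltW.
by rewrite f0 ?divr_gt0.
Qed.

(* [y `^ (-1)] is [y^-1] for [0 <= y], and is measurable on the whole line. *)
Definition inversion_map (R : realType) (K y : R) : R := K * y `^ (-1).

Lemma inversion_mapE (R : realType) (K y : R) :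
  0 < y -> inversion_map K y = K / y.
Proof. by move=> y0; rewrite /inversion_map powR_inv1// ltW. Qed.

Lemma measurable_inversion_map (R : realType) (K : R) :
  measurable_fun setT (inversion_map K).
Proof. by apply: measurable_funM => //; exact: measurable_powR. Qed.

Lemma measurable_preimage_inversion (R : realType) (K : R) (A : set R) :
  measurable A -> measurable (inversion_map K @^-1` A).
Proof.
by move=> mA; rewrite -[X in measurable X]setTI; exact: measurable_inversion_map.
Qed.

Lemma is_derive_inversion (R : realType) (K x : R) : x != 0 ->
  is_derive x 1 (fun y => K / y) (- (K / x ^+ 2)).
Proof.
move=> x0.
have h : is_derive x 1 (fun y : R => y^-1) (- x ^- 2 *: 1).
  by apply: is_deriveV => //; exact: is_derive_id.
rewrite (_ : - _ = K *: (- x ^- 2 *: 1)); last first.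
  by rewrite /GRing.scale/= mulr1 mulrN.
exact: is_deriveZ.
Qed.

Lemma derive1_inversion (R : realType) (K x : R) : x != 0 ->
  derive1 (fun y => K / y) x = - (K / x ^+ 2).
Proof.
by move=> x0; rewrite derive1E; have [_ ->] := is_derive_inversion K x0.
Qed.

Lemma continuous_derive1_inversion (R : realType) (K x : R) : 0 < x ->
  {for x, continuous (derive1 (fun y => K / y))}.
Proof.
move=> x0; rewrite /prop_for/continuous_at.
rewrite derive1_inversion ?gt_eqF//.
(* The formula for the derivative is available only away from 0, so the limit is computed for the
   formula and transferred on a neighbourhood of [x] made of positive points. *)
have : (fun y => - (K / y ^+ 2)) y @[y --> x] --> - (K / x ^+ 2).
  apply: cvgN; apply: cvgMr; apply: cvgV; first by rewrite expf_neq0 ?gt_eqF.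
  exact: exprn_continuous.
apply: cvg_trans; apply: near_eq_cvg.
near=> y; rewrite derive1_inversion//.
by rewrite gt_eqF//; near: y; exact: lt_nbhsr.
Unshelve. all: by end_near. Qed.

(** * Change of variables under the inversion *)

(** Substitution by a decreasing function. The half-open shapes correspond exactly: the inversion
    maps []a, b]] onto [[K / b, K / a[]. Endpoints are null, so both integrals are first moved to
    closed intervals, where the substitution rule applies. *)
Lemma integral_inversion_itv (R : realType) (K : R) (f : R -> R) (a b : R) :
  0 < K -> 0 < a -> a <= b ->
  {in `]0, +oo[, continuous f} ->
  (\int[lebesgue_measure]_(x in `[(K / b)%R, (K / a)%R[) (f x)%:E =
   \int[lebesgue_measure]_(x in `]a, b]) (K / x ^+ 2 * f (K / x))%:E)%E.
Proof.
move=> K0 a0 ab cf.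
have b0 : 0 < b by exact: lt_le_trans ab.
have mpos (h : R -> R) (i : interval R) : {in `]0, +oo[, continuous h} ->
    [set` i] `<=` `]0%R, +oo[ -> measurable_fun [set` i] (EFin \o h).
  move=> ch i0; apply/measurable_EFinP.
  exact: measurable_funS i0 (measurable_fun_continuous_pos ch).
rewrite integral_itv_bndo_bndc; last first.
  apply: mpos => // x/=; rewrite !in_itv/= andbT => /andP[+ _].
  by apply: lt_le_trans; rewrite divr_gt0.
rewrite integral_itv_obnd_cbnd; last first.
  apply: mpos => [|x/=]; first exact: continuous_inversion_density.
  by rewrite !in_itv/= andbT => /andP[+ _]; exact: lt_trans.
rewrite (@integration_by_substitution_decreasing _ (fun x => K / x))//.
- apply: eq_integral => x; rewrite inE/= in_itv/= => /andP[ax _].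
  have x0 : 0 < x by exact: lt_le_trans ax.
  (* The negative derivative cancels the sign that the decreasing substitution introduces. *)
  rewrite /= !fctE derive1_inversion ?gt_eqF//.
  by rewrite opprK mulrC.
- move=> x y; rewrite !in_itv/= => /andP[ax _] /andP[ay _] xy.
  by rewrite ltr_pM2l// ltf_pV2// posrE; exact: lt_le_trans a0 _.
- move=> x; rewrite in_itv/= => /andP[ax _].
  by apply: continuous_derive1_inversion; exact: lt_trans ax.
- apply/cvg_ex; eexists; apply: cvg_at_right_filter.
  exact: continuous_derive1_inversion.
- apply/cvg_ex; eexists; apply: cvg_at_left_filter.
  exact: continuous_derive1_inversion.
- split.
  + move=> x; rewrite in_itv/= => /andP[ax _].
    have x0 : x != 0 by rewrite gt_eqF// (lt_trans a0).
    by have [] := is_derive_inversion K x0.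
  + by apply: cvg_at_right_filter; exact: continuous_inversion.
  + by apply: cvg_at_left_filter; exact: continuous_inversion.
- apply: continuous_in_subspaceT => x; rewrite inE/= in_itv/= => /andP[bx _].
  by apply: cf; rewrite in_itv/= andbT; apply: lt_le_trans bx; rewrite divr_gt0.
Qed.

(** As functions of [A], both sides are measures. They agree on the open rays, which generate the
    Borel sets and are stable under intersection. Cutting down to [[a, b]] with [0 < a] makes these
    measures finite on the rays, as uniqueness requires. *)
Lemma integral_inversion_bounded (R : realType) (K : R) (f : R -> R) (a b : R)
    (A : set R) :
  0 < K -> 0 < a -> a <= b ->
  {in `]0, +oo[, continuous f} -> (forall x, 0 < x -> 0 <= f x) ->
  measurable A ->
  (\int[lebesgue_measure]_(x in inversion_map K @^-1` A `&` `[(K / b)%R, (K / a)%R[)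
     (f x)%:E =
   \int[lebesgue_measure]_(x in A `&` `]a, b]) (K / x ^+ 2 * f (K / x))%:E)%E.
Proof.
move=> K0 a0 ab cf f0 mA.
set g := fun x : R => K / x ^+ 2 * f (K / x).
set phi := inversion_map K.
have mphi : measurable_fun setT phi := @measurable_inversion_map R K.
have b0 : 0 < b by exact: lt_le_trans ab.
set E := `[(K / b)%R, (K / a)%R[%classic; set D := `]a, b]%classic.
have E0 : E `<=` `]0%R, +oo[.
  move=> x; rewrite /E/= !in_itv/= andbT => /andP[+ _].
  by apply: lt_le_trans; rewrite divr_gt0.
have D0 : D `<=` `]0%R, +oo[.
  by move=> x; rewrite /D/= !in_itv/= andbT => /andP[+ _]; apply: lt_trans.
have cg : {in `]0, +oo[, continuous g} by exact: continuous_inversion_density.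
have g0 : forall x, 0 < x -> 0 <= g x by exact: inversion_density_ge0.
have mfE : measurable_fun setT ((EFin \o f) \_ E).
  have mE : measurable E by exact: measurable_itv.
  apply/(measurable_restrictT (EFin \o f) mE)/measurable_EFinP.
  exact: measurable_funS E0 (measurable_fun_continuous_pos cf).
have mgD : measurable_fun setT ((EFin \o g) \_ D).
  have mD : measurable D by exact: measurable_itv.
  apply/(measurable_restrictT (EFin \o g) mD)/measurable_EFinP.
  exact: measurable_funS D0 (measurable_fun_continuous_pos cg).
have fE0 x : (0 <= ((EFin \o f) \_ E) x)%E.
  rewrite patchE; case: ifPn => // /set_mem /E0.
  by rewrite /= in_itv/= andbT lee_fin => /f0.
have gD0 x : (0 <= ((EFin \o g) \_ D) x)%E.
  rewrite patchE; case: ifPn => // /set_mem /D0.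
  by rewrite /= in_itv/= andbT lee_fin => /g0.
rewrite !integral_mkcondr.
pose rT : measurableType _ := measurableTypeR R.
have mid : measurable_fun [set: rT] (@idfun rT) by exact: measurable_id.
(* [m1] is the image under the inversion of the density [f] on [E]; [m2], an image under the
   identity, is just the density [g] on [D]. *)
pose m1 : {measure set rT -> \bar R} :=
  @image_density_measure R _ _ rT rT lebesgue_measure phi _ mphi mfE fE0.
pose m2 : {measure set rT -> \bar R} :=
  @image_density_measure R _ _ rT rT lebesgue_measure idfun _ mid mgD gD0.
rewrite -[LHS]/(m1 A) -[RHS]/(m2 A).
have phiE x : E x -> phi x = K / x.
  by move=> /E0; rewrite /= in_itv/= andbT; exact: inversion_mapE.
have m1E B : m1 B = (\int[lebesgue_measure]_(x in phi @^-1` B `&` E) (f x)%:E)%E.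
  by rewrite /m1 /= /image_density_measure -integral_mkcondr.
have m2E B : m2 B = (\int[lebesgue_measure]_(x in B `&` D) (g x)%:E)%E.
  by rewrite /m2 /= /image_density_measure -integral_mkcondr.
apply: (@measure_unique _ R rT (@RGenOInfty.G R)
  (fun k => `]- k%:R, +oo[%classic) _ _ _ _ m1 m2) => //.
- exact: RGenOInfty.measurableE.
- move=> _ _ [x ->] [y ->]; exists (Num.max x y).
  by apply/seteqP; split => z /=; rewrite !in_itv/= !andbT gt_max => /andP.
- by move=> k; eexists.
- rewrite -subTset => x _.
  have xk := archi_boundP (normr_ge0 (x : R)).
  exists (Num.bound `|x : R|) => //=; rewrite in_itv/= andbT ltrNl.
  by apply: le_lt_trans xk; rewrite -normrN ler_norm.
- move=> _ [x ->]; rewrite m1E m2E.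
  (* On the ray []x, +oo[] the two domains become []m, b]] and its inverse [[K / b, K / m[], which
     is the interval case with [m] in place of [a]. *)
  set m := Num.max x a.
  have m0 : 0 < m by rewrite lt_max a0 orbT.
  have -> : `]x, +oo[%classic `&` D = `]m, b]%classic.
    apply/seteqP; split => y /=; rewrite /D/= !in_itv/= andbT gt_max -andbA;
      by move/andP.
  have -> : phi @^-1` `]x, +oo[%classic `&` E = `[(K / b)%R, (K / m)%R[%classic.
    have mE y : 0 < y -> (y < K / m) = (x < K / y) && (y < K / a).
      move=> y0; rewrite !ltr_pdivlMr// ![y * _]mulrC -!ltr_pdivlMr//.
      by rewrite gt_max.
    apply/seteqP; split => y /=.
      move=> [+ Ey]; rewrite (phiE _ Ey) in_itv/= andbT => xy.
      move: (Ey) (E0 _ Ey); rewrite /E/= !in_itv/= andbT => /andP[-> ya] y0 /=.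
      by rewrite mE// xy.
    rewrite in_itv/= => /andP[yb ym].
    have y0 : 0 < y by apply: lt_le_trans yb; rewrite divr_gt0.
    move: ym; rewrite mE// => /andP[xy ya].
    have Ey : E y by rewrite /E/= in_itv/= yb.
    by split => //; rewrite (phiE _ Ey) in_itv/= xy.
  have [mb|bm] := leP m b; first exact: integral_inversion_itv.
  (* When the ray starts beyond [b], both intervals are empty. *)
  rewrite !set_itv_ge ?integral_set0//; last first.
    by rewrite bnd_simp -leNgt ler_pM2l// lef_pV2 ?posrE// ltW.
  by rewrite bnd_simp -leNgt ltW.
(* Finiteness: the mass is at most the integral of the continuous [f] over a compact interval of
   positive reals. *)
- move=> k; rewrite m1E.
  apply: (@le_lt_trans _ _
    (\int[lebesgue_measure]_(x in `[(K / b)%R, (K / a)%R]) (f x)%:E)%E).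
    apply: ge0_subset_integral => //.
    + apply: measurableI; last exact: measurable_itv.
      exact: (@measurable_preimage_inversion _ K `]- k%:R, +oo[%classic
        (measurable_itv _)).
    + apply/measurable_EFinP.
      apply: measurable_funS (measurable_fun_continuous_pos cf) => // x /=.
      rewrite !in_itv/= andbT => /andP[+ _].
      by apply: lt_le_trans; rewrite divr_gt0.
    + move=> x /=; rewrite in_itv/= => /andP[bx _]; rewrite lee_fin f0//.
      by apply: lt_le_trans bx; rewrite divr_gt0.
    + apply: (subset_trans (@subIsetr _ _ _)).
      by apply: subset_itvl; rewrite bnd_simp.
  rewrite -ge0_fin_numE; last first.
    apply: integral_ge0 => x /=; rewrite in_itv/= => /andP[bx _]; rewrite lee_fin f0//.
    by apply: lt_le_trans bx; rewrite divr_gt0.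
  apply: integrable_fin_num => //.
  apply: continuous_compact_integrable; first exact: segment_compact.
  apply: continuous_in_subspaceT => x; rewrite inE/= in_itv/= => /andP[bx _].
  by apply: cf; rewrite in_itv/= andbT; apply: lt_le_trans bx; rewrite divr_gt0.
Qed.

(** Monotone convergence along the exhaustion of the half-line by []1 / (n + 1), n + 1]], whose
    inverse intervals also exhaust it. No integrability is assumed: the two sides may both be
    infinite. *)
Lemma integral_inversion (R : realType) (K : R) (f : R -> R) (A : set R) :
  0 < K -> {in `]0, +oo[, continuous f} -> (forall x, 0 < x -> 0 <= f x) ->
  measurable A ->
  (\int[lebesgue_measure]_(x in inversion_map K @^-1` A `&` `]0%R, +oo[) (f x)%:E =
   \int[lebesgue_measure]_(x in A `&` `]0%R, +oo[) (K / x ^+ 2 * f (K / x))%:E)%E.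
Proof.
move=> K0 cf f0 mA.
set g := fun x : R => K / x ^+ 2 * f (K / x).
set phi := inversion_map K.
have cg : {in `]0, +oo[, continuous g} by exact: continuous_inversion_density.
have g0 : forall x, 0 < x -> 0 <= g x by exact: inversion_density_ge0.
pose a (n : nat) : R := n.+1%:R^-1; pose b (n : nat) : R := n.+1%:R.
have a0 n : 0 < a n by rewrite invr_gt0 ltr0n.
have b0 n : 0 < b n by rewrite ltr0n.
have ab n : a n <= b n.
  by rewrite (@le_trans _ _ 1)// ?invf_le1 ?ltr0n ?ler1n.
have na n m : (n <= m)%N -> a m <= a n.
  by move=> nm; rewrite lef_pV2 ?posrE ?ltr0n// ler_nat.
have nb n m : (n <= m)%N -> b n <= b m by move=> nm; rewrite ler_nat.
pose D n := `]a n, b n]%classic : set R.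
pose E n := `[K / b n, K / a n[%classic : set R.
have D0 n : D n `<=` `]0%R, +oo[.
  by move=> x; rewrite /D/= !in_itv/= andbT => /andP[+ _]; apply: lt_trans.
have E0 n : E n `<=` `]0%R, +oo[.
  move=> x; rewrite /E/= !in_itv/= andbT => /andP[+ _].
  by apply: lt_le_trans; rewrite divr_gt0.
have lim_int (h : R -> R) (B : set R) (F : nat -> interval R) :
    {in `]0, +oo[, continuous h} -> (forall x, 0 < x -> 0 <= h x) ->
    measurable B -> (forall n m, (n <= m)%N -> [set` F n] `<=` [set` F m]) ->
    \bigcup_n [set` F n] = `]0%R, +oo[%classic ->
    (\int[lebesgue_measure]_(x in B `&` [set` F n]) (h x)%:E)%E @[n --> \oo] -->
    (\int[lebesgue_measure]_(x in B `&` `]0%R, +oo[) (h x)%:E)%E.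
  move=> ch h0 mB ndF UF.
  have F0 : \bigcup_n [set` F n] `<=` `]0%R, +oo[ by rewrite UF.
  rewrite -UF setI_bigcupr; apply: ge0_nondecreasing_set_cvg_integral.
  - by move=> n m nm; rewrite subsetEset; apply: setIS; exact: ndF.
  - by move=> n; apply: measurableI => //; exact: measurable_itv.
  - move=> n; apply/measurable_EFinP.
    apply: measurable_funS (measurable_fun_continuous_pos ch) => //.
    by move=> x [_ Fx]; apply: F0; exists n.
  - move=> n x [_ Fx]; rewrite lee_fin h0//.
    by have := F0 x; rewrite /= in_itv/= andbT; apply; exists n.
have large x : 0 < x -> exists n, a n < x < b n.
  (* An integer above [x + x^-1] bounds [x] and its inverse at once, so a single [n] serves for both
     ends. *)
  move=> x0; have y0 : 0 <= x + x^-1 by rewrite addr_ge0 ?invr_ge0 ?ltW.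
  have := archi_boundP y0; set n := Num.Def.archi_bound _ => xn.
  have nn : n%:R < b n by rewrite ltr_nat.
  exists n; apply/andP; split.
    rewrite /a invf_plt ?posrE ?ltr0n//; apply: le_lt_trans (lt_trans xn nn).
    by rewrite lerDr ltW.
  by apply: le_lt_trans (lt_trans xn nn); rewrite lerDl invr_ge0 ltW.
have ndE n m : (n <= m)%N -> E n `<=` E m.
  move=> nm; apply: subset_itv; rewrite bnd_simp.
    by rewrite ler_pM2l// lef_pV2 ?posrE// nb.
  by rewrite ler_pM2l// lef_pV2 ?posrE// na.
have ndD n m : (n <= m)%N -> D n `<=` D m.
  by move=> nm; apply: subset_itv; rewrite bnd_simp ?na ?nb.
have UE : \bigcup_n E n = `]0%R, +oo[%classic.
  apply/seteqP; split => [x [n _]|x]; first exact: E0.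
  rewrite /= in_itv/= andbT => x0.
  (* A point lies in [E n] exactly when its inverse [K / x] lies in [D n]. *)
  have [n /andP[ax xb]] := large (K / x) (divr_gt0 K0 x0).
  exists n => //=; rewrite /E/= in_itv/= ler_pdivrMr// ltr_pdivlMr//.
  rewrite mulrC -ler_pdivrMr//.
  by rewrite ltW//= mulrC -ltr_pdivlMr.
have UD : \bigcup_n D n = `]0%R, +oo[%classic.
  apply/seteqP; split => [x [n _]|x]; first exact: D0.
  rewrite /= in_itv/= andbT => x0.
  have [n /andP[ax xb]] := large x x0.
  by exists n => //=; rewrite /D/= in_itv/= ax ltW.
have limE := lim_int f (phi @^-1` A) (fun n => `[K / b n, K / a n[) cf f0
  (measurable_preimage_inversion K mA) ndE UE.
have limD := lim_int g A (fun n => `]a n, b n]) cg g0 mA ndD UD.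
rewrite -(cvg_lim _ limE)// -(cvg_lim _ limD)//.
congr (limn _); apply/funext => n; exact: integral_inversion_bounded.
Qed.

(** * Uniqueness of continuous densities *)

(** If [f] and [g] differed at a point of [D], they would differ on a whole ball inside [D]; that
    ball has positive length, yet lies in a null set. *)
Lemma eq_continuous_ae (R : realType) (D : set R) (f g : R -> R) :
  open D -> {in D, continuous f} -> {in D, continuous g} ->
  ae_eq lebesgue_measure D f g -> {in D, f =1 g}.
Proof.
move=> oD cf cg [N [mN N0 DN]] x xD; apply/eqP/contraT => fgx.
have : nbhs x (D `&` [set y | f y != g y]).
  apply: filterI; first by move: oD; rewrite openE; apply; exact: set_mem.
  have fgc : (f y - g y) @[y --> x] --> f x - g x.
    by apply: cvgB; [exact: cf|exact: cg].
  have : \forall y \near x, f y - g y != 0.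
    by apply: cvgr_neq0 fgc _; rewrite subr_eq0.
  by apply: filterS => y /=; rewrite subr_eq0.
move=> /nbhs_ballP[e /= e0 eD].
have := @lebesgue_measure_ball R x e (ltW e0).
rewrite (@subset_measure0 _ _ _ lebesgue_measure (ball x e) N)//; last 2 first.
- exact: measurable_ball.
- move=> y /eD[Dy /= /eqP fgy]; apply: DN => /= H; exact: fgy (H Dy).
have : 0 < e *+ 2 by rewrite pmulrn_lgt0.
by move=> + [he]; rewrite -he ltxx.
Qed.

(** Two densities of one law have the same integral over every Borel set, hence agree almost
    everywhere; continuity removes the exceptional set. *)
Lemma has_density_unique (R : realType) (disp : measure_display)
    (T : measurableType disp) (P : probability T R) (Y : T -> R) (p q : R -> R) :
  has_density P Y `]0, +oo[ p -> has_density P Y `]0, +oo[ q ->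
  {in `]0, +oo[, continuous p} -> {in `]0, +oo[, continuous q} ->
  {in `]0, +oo[, p =1 q}.
Proof.
move=> [mY mp p0 Pp] [_ mq q0 Pq] cp cq x x0.
apply: (@eq_continuous_ae R `]0, +oo[%classic) => //; last by rewrite inE.
- by move=> y; rewrite inE; exact: cp.
- by move=> y; rewrite inE; exact: cq.
suff : ae_eq lebesgue_measure (`]0, +oo[%classic : set R) (EFin \o p) (EFin \o q).
  by apply: filterS => y /= pq y0; case: (pq y0).
apply: integral_ae_eq => //.
- apply/integrableP; split; first exact/measurable_EFinP.
  (* The integral of [|p|] is the total mass of the probability, hence finite. *)
  apply: (@le_lt_trans _ _ (P (Y @^-1` setT))); last first.
    by rewrite preimage_setT probability_setT ltry.
  rewrite Pp// setTI le_eqVlt; apply/orP; left; apply/eqP.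
  by apply: eq_integral => y; rewrite inE => /p0 py; rewrite /= ger0_norm.
- exact/measurable_EFinP.
- by move=> B BD mB; have := Pp _ mB; rewrite Pq// setIidl// => ->.
Qed.

(** * Law of the reflected variable *)

(** The event is split according to whether [Y] is kept or inverted. The kept part contributes [p];
    the inverted part is brought back to []0, S]] by the change of variables with [K = S ^+ 2]. *)
Lemma has_density_reflection (R : realType) (disp : measure_display)
    (T : measurableType disp) (P : probability T R) (Y : T -> R) (p : R -> R)
    (S : R) :
  0 < S -> has_density P Y `]0, +oo[ p -> {in `]0, +oo[, continuous p} ->
  has_density P (fun w => if Y w < S then Y w else S ^+ 2 / Y w) `]0, S]
    (fun x => p x + S ^+ 2 / x ^+ 2 * p (S ^+ 2 / x)).
Proof.
move=> S0 [mY mp p0 Pp] cp.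
have SS0 : 0 < S ^+ 2 by rewrite exprn_gt0.
have p0' x : 0 < x -> 0 <= p x by move=> x0; apply: p0; rewrite /= in_itv/= x0.
pose phi := inversion_map (S ^+ 2).
have phiE y : 0 < y -> phi y = S ^+ 2 / y by exact: inversion_mapE.
have phiS y : 0 < y -> (phi y <= S) = (S <= y).
  by move=> y0; rewrite phiE// ler_pdivrMr// expr2 ler_pM2l.
(* The reflection as a measurable map of the line. Inversion occurs only for [S <= y], where [y] is
   positive and [phi y] is the true quotient. *)
pose r y : R := if y < S then y else phi y.
have mr : measurable_fun setT r.
  apply: measurable_fun_ifT => //; first exact: measurable_fun_ltr.
  exact: measurable_inversion_map.
have rE w : (if Y w < S then Y w else S ^+ 2 / Y w) = r (Y w).
  by rewrite /r; case: ltP => // SY; rewrite phiE// (lt_le_trans S0).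
pose g x : R := S ^+ 2 / x ^+ 2 * p (S ^+ 2 / x).
have cg : {in `]0, +oo[, continuous g} by exact: continuous_inversion_density.
have g0 : forall x, 0 < x -> 0 <= g x by exact: inversion_density_ge0.
have D0 : `]0%R, S] `<=` (`]0%R, +oo[%classic : set R).
  by apply: subset_itvl; rewrite bnd_simp.
have mgp : measurable_fun (`]0, +oo[%classic : set R) g.
  by exact: measurable_fun_continuous_pos.
have mpD := measurable_funS (measurable_itv _) D0 mp.
have mgD := measurable_funS (measurable_itv _) D0 mgp.
split.
- by under eq_fun do rewrite rE; exact: measurableT_comp.
- exact: measurable_funD.
- move=> x /D0; rewrite /= in_itv/= andbT => x0.
  by rewrite addr_ge0 ?p0'//; exact: g0.
move=> A mA.
have mAD : measurable (A `&` `]0%R, S]).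
  by apply: measurableI => //; exact: measurable_itv.
have mrA : measurable (r @^-1` A).
  by rewrite -[X in measurable X]setTI; exact: mr.
have mphiA : measurable (phi @^-1` (A `&` `]0%R, S]) `&` `]0%R, +oo[).
  apply: measurableI; last exact: measurable_itv.
  exact: measurable_preimage_inversion.
have mpI (B : set R) : B `<=` `]0%R, +oo[ -> measurable_fun B (EFin \o p).
  by move=> B0; apply/measurable_EFinP; exact: measurable_funS B0 mp.
have mgI (B : set R) : B `<=` `]0%R, +oo[ -> measurable_fun B (EFin \o g).
  by move=> B0; apply/measurable_EFinP; exact: measurable_funS B0 mgp.
have -> : (fun w => if Y w < S then Y w else S ^+ 2 / Y w) @^-1` A =
    Y @^-1` (r @^-1` A).
  by apply/seteqP; split => w /=; rewrite rE.
rewrite Pp//.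
(* For positive [y], [phi y <= S] means [S <= y], so the second piece collects the inverted points.
   The fixed point [S] belongs to that piece; it is removed from the first to make the union
   disjoint, and put back below since a point is null. *)
have -> : r @^-1` A `&` `]0%R, +oo[ =
    ((A `&` `]0%R, S]) `\ S) `|` (phi @^-1` (A `&` `]0%R, S]) `&` `]0%R, +oo[).
  apply/seteqP; split => y /=; rewrite !in_itv/= !andbT.
    move=> [+ y0]; rewrite /r; case: ltP => [yS Ay|Sy Ay].
      by left; rewrite y0 ltW//; split => //; apply/eqP; rewrite lt_eqF.
    by right; rewrite phiS// Sy phiE// divr_gt0// -phiE.
  move=> [[[Ay /andP[y0 yS]] /eqP yneS]|[[Ay +] y0]].
    have ylS : y < S by rewrite lt_neqAle yneS yS.
    by rewrite /r ylS.
  by rewrite phiS// => /andP[_ Sy]; rewrite /r ltNge Sy.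
have AD0 : A `&` `]0%R, S] `<=` `]0%R, +oo[ by move=> x [_ /D0].
rewrite ge0_integral_setU//=; last 4 first.
- exact: measurableD.
- by apply: mpI => x [[/AD0//]|[]].
- by move=> x [[/AD0+ _]|[_]]; rewrite /= in_itv/= andbT lee_fin => /p0'.
- apply/disj_setPS => x [[[_ /=]]]; rewrite !in_itv/= => /andP[x0 xS] /eqP xneS.
  move=> [[_ /andP[_ +]] _].
  by rewrite phiS// leNgt lt_neqAle xneS xS.
rewrite integral_setD1; [|exact: measurableD|by apply: mpI => x [/AD0]].
rewrite integral_inversion// -setIA (setIidl D0).
rewrite -ge0_integralD//.
- by move=> x /AD0; rewrite /= in_itv/= andbT lee_fin => /p0'.
- exact: mpI.
- by move=> x /AD0; rewrite /= in_itv/= andbT lee_fin => /g0.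
- exact: mgI.
Qed.

(** * Continuity in the space variable, and the theorem *)

Lemma kernel_pde_continuous (R : realType) (d : nat) (u : R -> R -> R) (t : R) :
  kernel_pde d u -> 0 < t -> {in `]0, +oo[, continuous (u^~ t)}.
Proof.
move=> hu t0 x; rewrite in_itv/= andbT => x0.
have [_ dux _ _] := hu x t x0 t0.
by apply/differentiable_continuous/derivable1_diffP.
Qed.

Lemma sinh_gt0 (R : realType) (x : R) : 0 < x -> 0 < sinh x.
Proof. by move=> x0; rewrite divr_gt0// subr_gt0 ltr_expR; lra. Qed.

Lemma continuous_sinh (R : realType) : continuous (@sinh R).
Proof.
move=> x; apply: cvgMl; apply: cvgB; first exact: continuous_expR.
apply: (cvg_comp -%R expR); last exact: continuous_expR.
exact: cvgN.
Qed.

Theorem theorem5 (R : realType) (d : nat) (hd : (2 <= d)%N) (S : R) (hS : 0 < S)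
    (disp : measure_display) (T : measurableType disp) (P : probability T R)
    (eta : R -> T -> R) (heta : hyperbolic_bessel P d eta)
    (u : R -> R -> R) (hu : bessel_kernel P d eta u)
    (ubar : R -> R -> R) (hubar : reflecting_bessel_kernel P d S eta ubar)
    (t : R) (ht : 0 < t) :
  (forall x : R, 0 < x <= S -> ubar x t = u x t + u (S ^+ 2 / x) t) /\
  has_density P (reflecting_bessel S eta t) `]0, S]
    (fun x : R => sinh x ^+ d.-1 * u x t
       + (S / x) ^+ 2 * sinh (S ^+ 2 / x) ^+ d.-1 * u (S ^+ 2 / x) t).
Proof.
(* Stated for an arbitrary kernel because it serves for [u] and for the kernel [v] hidden in
   [hubar]. *)
have cdens v : bessel_kernel P d eta v ->
    {in `]0, +oo[, continuous (fun x => v x t * sinh x ^+ d.-1)}.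
  move=> [hv _ _] x x0; apply: cvgM; first exact: (kernel_pde_continuous hv).
  apply: (cvg_comp (@sinh R) (fun y => y ^+ d.-1)); last exact: exprn_continuous.
  exact: continuous_sinh.
split.
- have [v hv vE] := hubar => x /andP[x0 xS].
  (* Uniqueness identifies the densities [v * sinh ^ (d - 1)] and [u * sinh ^ (d - 1)]; the common
     factor is nonzero for [y > 0] and cancels. *)
  have uv y : 0 < y -> v y t = u y t.
    move=> y0; apply: (@mulIf _ (sinh y ^+ d.-1)).
      by rewrite expf_neq0// gt_eqF// sinh_gt0.
    have [_ _ /(_ t ht) dv] := hv; have [_ _ /(_ t ht) du] := hu.
    apply: (has_density_unique dv du (cdens _ hv) (cdens _ hu)).
    by rewrite in_itv/= y0.
  have y0 : 0 < S ^+ 2 / x by rewrite divr_gt0 ?exprn_gt0.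
  rewrite (vE x (S ^+ 2 / x)) ?x0 ?uv//; split => //.
  by rewrite mulrC divfK ?gt_eqF.
- have [_ _ /(_ t ht) du] := hu.
  (* The two forms of the density agree as functions on all of [R]: with division by 0 equal to 0,
     the identity between [(S / x) ^+ 2] and [S ^+ 2 / x ^+ 2] holds at 0 too. *)
  rewrite [X in has_density _ _ _ X](_ : _ = fun x =>
      u x t * sinh x ^+ d.-1 +
      S ^+ 2 / x ^+ 2 * (u (S ^+ 2 / x) t * sinh (S ^+ 2 / x) ^+ d.-1)).
    by apply: (has_density_reflection hS du); exact: (cdens _ hu).
  apply/funext => x.
  by rewrite (expr_div_n S x) [u x t * _]mulrC [u _ t * _]mulrC mulrA.
Qed.
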